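(* Let $\Lambda$ be a ring, $S$ a nonempty set, and for each $p\in S$ let $d_p$ be a function assigning to every $\Lambda$-module an element of $\{0,1,2,\dots\}\cup\{\infty\}$. Let $f\colon S\to\{0,1,2,\dots\}\cup\{\infty\}$ be a function and $U$ a subset of $S$. Then: (1) For every $\Lambda$-module $N$, $\widetilde{S}^{f}(N)=\inf\{d_{p}(N)\mid p\in Y^{f}(N)\}$. (2) If $d_{p}$ satisfies $(\widetilde{d1})$ (resp. (d3); resp. all of (d1), (d2), (d3)) for every $p\in S$, then the function $T^{U}$ also satisfies $(\widetilde{d1})$ (resp. (d3); resp. all of (d1), (d2), (d3)). (3) If $d_{p}$ satisfies $(\widetilde{d1})$ (resp. (d3)) for every $p\in S$, then the function $\widetilde{S}^{f}$ also satisfies $(\widetilde{d1})$ (resp. (d3)).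
   Context: Infimum of the empty set is $\infty$. Conditions on a function $d$ from $\Lambda$-modules to $\{0,1,\dots\}\cup\{\infty\}$, required for every short exact sequence $0\to K\to L\to N\to0$ of $\Lambda$-modules: $(\widetilde{d1})$ if $d(L)>d(K)$, then $d(K)\ge d(N)+1$; (d1) if $d(L)>d(K)$, then $d(K)=d(N)+1$; (d2) if $d(L)>d(N)$, then $d(K)=d(N)+1$; (d3) if $d(L)<d(N)$, then $d(K)\le d(L)$. For a $\Lambda$-module $N$: $N$ satisfies $\widetilde{S}^f_i$ ($i$ an integer) if $d_p(N)\ge\inf\{i,f(p)\}$ for all $p\in S$; $\widetilde{S}^f(N)=\sup\{i\mid N\text{ satisfies }\widetilde{S}^f_i\}$; $Y^f(N)=\{p\in S\mid d_p(N)<f(p)\}$; $T^U(N)=\inf\{d_p(N)\mid p\in U\}$. *)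

(* Defs.v *)
From HB Require Import structures.
From mathcomp Require Import all_boot all_order all_algebra.
From mathcomp Require Import boolp classical_sets constructive_ereal.

Set Implicit Arguments.
Unset Strict Implicit.
Unset Printing Implicit Defensive.

Import Order.TTheory GRing.Theory Num.Theory.

Local Open Scope classical_set_scope.
Local Open Scope ereal_scope.

(* {0, 1, 2, ...} together with infinity, as the nonnegative part of the
   extended integers *)
Definition enat := {x : \bar int | 0 <= x}.

Definition eint_of_enat (x : enat) : \bar int := val x.
Coercion eint_of_enat : enat >-> extended.

Lemma enat_ge0 (x : enat) : 0 <= (x : \bar int).
Proof. exact: (valP x). Qed.

Definition einf (A : set (\bar int)) : \bar int := infimum +oo A.

Definition esup (A : set (\bar int)) : \bar int := supremum -oo A.

(* Every set of extended integers has an infimum and a supremum, so the default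
   values above are only reached on the empty set. *)

Lemma infimums_neq0 (A : set (\bar int)) : infimums A !=set0.
Proof.
have [/asboolP [m Am]|/asboolPn noFin] :=
    boolP `[< exists m : int, A m%:E \/ A -oo >].
  have [/asboolP [b lbA]|/asboolPn noLb] :=
      boolP `[< exists b : int, lbound A b%:E >].
    have {}Am : A m%:E by case: Am => // /lbA; rewrite leeNy_eq.
    pose P n := `[< A (b + n%:Z)%R%:E >].
    have bm : (b <= m)%R by have := lbA _ Am; rewrite lee_fin.
    have exP : exists n, P n.
      exists `|m - b|%N; apply/asboolP.
      by rewrite gez0_abs ?subr_ge0// [(b + _)%R]addrC subrK.
    case: (ex_minnP exP) => n /asboolP An minn.
    exists (b + n%:Z)%R%:E; split; last by move=> y; apply.
    case=> [x Ax| _|/lbA]; rewrite ?leey// ?leeNy_eq//.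
    have bx : (b <= x)%R by have := lbA _ Ax; rewrite lee_fin.
    have /minn : P `|x - b|%N.
      by apply/asboolP; rewrite gez0_abs ?subr_ge0// [(b + _)%R]addrC subrK.
    rewrite -lez_nat gez0_abs ?subr_ge0// => h.
    by rewrite lee_fin -lerBrDl.
  exists -oo; split=> [x _|]; first exact: leNye.
  case=> [b lbb|lby|_]; last exact: lexx.
    by case: noLb; exists b.
  by case: Am => /lby; rewrite leye_eq.
exists +oo; split=> [|y _]; last exact: leey.
case=> [r Ar|_|ANy]; [|exact: lexx|].
  by case: noFin; exists r; left.
by case: noFin; exists 0%R; right.
Qed.

Lemma supremums_neq0 (A : set (\bar int)) : supremums A !=set0.
Proof.
have [s [lbs ubs]] := infimums_neq0 (ubound A).
by exists s; split=> // x Ax; apply: ubs => y; apply.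
Qed.

Lemma einf_infimums (A : set (\bar int)) : infimums A (einf A).
Proof.
rewrite /einf /infimum; case: ifPn => [/eqP ->|_].
  by split=> [//|y _]; exact: leey.
by have [x Ax] := infimums_neq0 A; case: xgetP => // /(_ x).
Qed.

Lemma esup_supremums (A : set (\bar int)) : supremums A (esup A).
Proof.
rewrite /esup /supremum; case: ifPn => [/eqP ->|_].
  by split=> [//|y _]; exact: leNye.
by have [x Ax] := supremums_neq0 A; case: xgetP => // /(_ x).
Qed.

Definition short_exact (R : pzRingType) (K L N : lmodType R)
    (u : {linear K -> L}) (v : {linear L -> N}) : Prop :=
  [/\ injective u,
      (forall y : L, v y = 0%R <-> exists x : K, u x = y) &
      (forall z : N, exists y : L, v y = z)].

Section Conditions.
Variables (R : pzRingType) (d : lmodType R -> enat).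

Definition cond_d1tilde : Prop :=
  forall (K L N : lmodType R) (u : {linear K -> L}) (v : {linear L -> N}),
    short_exact u v -> d L > d K -> d K >= d N + 1.

Definition cond_d1 : Prop :=
  forall (K L N : lmodType R) (u : {linear K -> L}) (v : {linear L -> N}),
    short_exact u v -> d L > d K -> d K = d N + 1 :> \bar int.

Definition cond_d2 : Prop :=
  forall (K L N : lmodType R) (u : {linear K -> L}) (v : {linear L -> N}),
    short_exact u v -> d L > d N -> d K = d N + 1 :> \bar int.

Definition cond_d3 : Prop :=
  forall (K L N : lmodType R) (u : {linear K -> L}) (v : {linear L -> N}),
    short_exact u v -> d L < d N -> d K <= d L.

End Conditions.

Section Families.
Variables (R : pzRingType) (S : Type) (d : S -> lmodType R -> enat).

Definition satisfies_Stilde (f : S -> enat) (i : int) (N : lmodType R) : Prop :=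
  forall p : S, d p N >= Order.min i%:E (f p).

Definition Stilde_val (f : S -> enat) (N : lmodType R) : \bar int :=
  esup [set i%:E | i in [set i : int | satisfies_Stilde f i N]].

Lemma Stilde_val_ge0 (f : S -> enat) (N : lmodType R) : 0 <= Stilde_val f N.
Proof.
have [ub _] := esup_supremums [set i%:E | i in [set i | satisfies_Stilde f i N]].
by apply: ub; exists 0%R => // p; rewrite ge_min enat_ge0.
Qed.

Definition Stilde (f : S -> enat) (N : lmodType R) : enat :=
  exist (fun x : \bar int => 0 <= x) (Stilde_val f N) (Stilde_val_ge0 f N).

Definition Y (f : S -> enat) (N : lmodType R) : set S :=
  [set p | d p N < f p].

Definition T_val (U : set S) (N : lmodType R) : \bar int :=
  einf [set (d p N : \bar int) | p in U].

Lemma T_val_ge0 (U : set S) (N : lmodType R) : 0 <= T_val U N.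
Proof.
have [_ ub] := einf_infimums [set (d p N : \bar int) | p in U].
by apply: ub => _ [p _ <-]; exact: enat_ge0.
Qed.

Definition T (U : set S) (N : lmodType R) : enat :=
  exist (fun x : \bar int => 0 <= x) (T_val U N) (T_val_ge0 U N).

End Families.

(* Main.v *)
(** The condition [min i (f p) <= d p N] only constrains [i] when [d p N < f p],
    so Stilde is an infimum over [Y f N]. A finite infimum of values in
    {0, 1, ...} is attained at some [p], and each condition transfers by applying
    it to [d p] for the [p] attaining the smaller side of its hypothesis; for
    Stilde one also uses that [d p M >= Stilde f M] or [d p M >= f p] for all
    [p] and [M]. *)

Require Import Defs.
From HB Require Import structures.
From mathcomp Require Import all_boot all_order all_algebra.
From mathcomp Require Import boolp classical_sets constructive_ereal.

Import Order.TTheory GRing.Theory Num.Theory.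

Local Open Scope classical_set_scope.
Local Open Scope ereal_scope.

Set Implicit Arguments.
Unset Strict Implicit.

(** Integrality enters here; the infinite cases hold because [-oo + 1] is [-oo] and nothing exceeds
    [+oo]. *)
Lemma lte_add1_le (x y : \bar int) : x < y -> x + 1 <= y.
Proof.
case: x y => [x| |] [y| |] //=; rewrite ?leey ?leNye //.
by rewrite lte_fin lee_fin lezD1.
Qed.

Lemma einf_le (A : set (\bar int)) (x : \bar int) : A x -> einf A <= x.
Proof. by have [lb _] := einf_infimums A; exact: lb. Qed.

Lemma le_einf (A : set (\bar int)) (x : \bar int) : lbound A x -> x <= einf A.
Proof. by have [_ glb] := einf_infimums A; exact: glb. Qed.

(* If the finite infimum m were not attained, m + 1 would be a lower bound. *)
Lemma einf_attained (A : set (\bar int)) :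
  einf A != -oo -> einf A < +oo -> A (einf A).
Proof.
move=> ANy Ay; apply: contrapT => nA.
have : einf A + 1 <= einf A.
  apply: le_einf => x Ax; apply: lte_add1_le.
  rewrite lt_neqAle einf_le // andbT.
  by apply/eqP => e; apply: nA; rewrite e.
move: ANy Ay; case: (einf A) => [m| |] //= _ _.
by rewrite lee_fin lezD1 ltxx.
Qed.

Section Proposition.
Variables (R : pzRingType) (S : Type) (d : S -> lmodType R -> enat).
Implicit Types (U : set S) (f : S -> enat) (K L N : lmodType R) (p : S).

Lemma T_le U N p : U p -> (T d U N : \bar int) <= d p N.
Proof. by move=> Up; apply: einf_le; exists p. Qed.

Lemma T_attained U N :
  (T d U N : \bar int) < +oo -> exists2 p, U p & d p N = T d U N :> \bar int.
Proof.
move=> Ty; have [||p Up e] := @einf_attained [set (d p N : \bar int) | p in U].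
- by rewrite gt_eqF // (lt_le_trans _ (T_val_ge0 d U N)).
- exact: Ty.
by exists p.
Qed.

Lemma satisfies_Stilde_T f (i : int) N :
  satisfies_Stilde d f i N <-> i%:E <= T d (Y d f N) N.
Proof.
split=> [iN|iT p].
  apply: le_einf => _ [p Yp <-]; have := iN p.
  by rewrite ge_min => /orP[//|]; rewrite leNgt Yp.
rewrite ge_min; case: (leP (f p : \bar int) (d p N)) => [_|Yp].
  by rewrite orbT.
by rewrite (le_trans iT) // T_le.
Qed.

Lemma Stilde_T f N : Stilde d f N = T d (Y d f N) N :> \bar int.
Proof.
have [ub lub] :=
  esup_supremums [set i%:E | i in [set i | satisfies_Stilde d f i N]].
apply/eqP; rewrite eq_le; apply/andP; split.
  by apply: lub => _ [i /satisfies_Stilde_T iN <-].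
have le_S (i : int) :
    i%:E <= T d (Y d f N) N -> i%:E <= (Stilde d f N : \bar int).
  by move=> iT; apply: ub; exists i => //; apply/satisfies_Stilde_T.
(* Nonnegativity leaves two cases for the infimum: an integer, itself an admissible index, or [+oo],
   where every integer is admissible and the supremum cannot be an integer [s] because of
   [s + 1]. *)
move: (enat_ge0 (T d (Y d f N) N)) le_S.
case: (eint_of_enat (T d (Y d f N) N)) => [t| |] // _ le_S; first exact: le_S.
move: le_S; case: (eint_of_enat (Stilde d f N)) => [s| |] // le_S.
  by have := le_S (s + 1)%R (leey _); rewrite lee_fin lezD1 ltxx.
by have := le_S 0%R (leey _).
Qed.

Lemma Stilde_le f N p : Y d f N p -> (Stilde d f N : \bar int) <= d p N.
Proof. by rewrite Stilde_T; exact: T_le. Qed.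

Lemma Stilde_attained f N : (Stilde d f N : \bar int) < +oo ->
  exists2 p, Y d f N p & d p N = Stilde d f N :> \bar int.
Proof. by rewrite Stilde_T; exact: T_attained. Qed.

(** [Y d f N] varies with [N], so an index [p] attaining the value at one module may lie outside it
    for another. The bound [x < f p] makes up for this. *)
Lemma lt_Stilde f N p (x : \bar int) :
  x < f p -> x < Stilde d f N -> x < d p N.
Proof.
move=> xf xS; case: (ltP (d p N : \bar int) (f p)) => [Yp|].
  exact: lt_le_trans xS (Stilde_le Yp).
exact: lt_le_trans.
Qed.

Lemma T_d1tilde U : (forall p, cond_d1tilde (d p)) -> cond_d1tilde (T d U).
Proof.
move=> d1t K L N u v uv KL.
(* A value strictly below another is not [+oo], hence attained. *)
have [p Up pK] := T_attained (lt_le_trans KL (leey _)).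
rewrite -pK; apply: le_trans (d1t p _ _ _ _ _ uv _).
  by rewrite leeD2r // T_le.
by rewrite pK (lt_le_trans KL) // T_le.
Qed.

Lemma T_d3 U : (forall p, cond_d3 (d p)) -> cond_d3 (T d U).
Proof.
move=> d3 K L N u v uv LN.
have [p Up pL] := T_attained (lt_le_trans LN (leey _)).
rewrite -pL; apply: le_trans (T_le _ Up) (d3 p _ _ _ _ _ uv _).
by rewrite pL (lt_le_trans LN) // T_le.
Qed.

(** The upper half of the equality in both (d1) and (d2): an index attaining the infimum at [N]
    satisfies the hypothesis of (d2). *)
Lemma T_lt_le U K L N (u : {linear K -> L}) (v : {linear L -> N}) :
  (forall p, cond_d2 (d p)) -> short_exact u v ->
  T d U N < T d U L -> (T d U K : \bar int) <= T d U N + 1.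
Proof.
move=> d2 uv NL.
have [p Up pN] := T_attained (lt_le_trans NL (leey _)).
rewrite -pN -(d2 p _ _ _ _ _ uv); first exact: T_le.
by rewrite pN (lt_le_trans NL) // T_le.
Qed.

Lemma cond_d1_d1tilde (e : lmodType R -> enat) : cond_d1 e -> cond_d1tilde e.
Proof. by move=> d1 K L N u v uv /(d1 _ _ _ _ _ uv) ->. Qed.

Lemma T_d1 U : (forall p, cond_d1 (d p)) -> (forall p, cond_d2 (d p)) ->
  cond_d1 (T d U).
Proof.
move=> d1 d2 K L N u v uv KL.
have NK : T d U N + 1 <= (T d U K : \bar int).
  exact: (T_d1tilde (fun p => cond_d1_d1tilde (d1 p)) uv KL).
apply/eqP; rewrite eq_le NK andbT; apply: (T_lt_le d2 uv).
(* The chain [T N <= T N + 1 <= T K < T L] supplies the strict inequality that [T_lt_le] asks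
   for. *)
by apply: le_lt_trans KL; apply: le_trans NK; rewrite leeDl.
Qed.

Lemma T_d2 U : (forall p, cond_d1 (d p)) -> (forall p, cond_d2 (d p)) ->
  cond_d2 (T d U).
Proof.
move=> d1 d2 K L N u v uv NL.
(* Either (d1) applies, or [T L <= T K] and integrality gives [T N + 1 <= T L <= T K]. *)
case: (ltP (T d U K : \bar int) (T d U L)) => [KL|LK].
  exact: (T_d1 d1 d2 uv KL).
apply/eqP; rewrite eq_le (T_lt_le d2 uv NL) /=.
exact: le_trans (lte_add1_le NL) LK.
Qed.

Lemma Stilde_d1tilde f :
  (forall p, cond_d1tilde (d p)) -> cond_d1tilde (Stilde d f).
Proof.
move=> d1t K L N u v uv KL.
have [p Yp pK] := Stilde_attained (lt_le_trans KL (leey _)).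
have NK : d p N + 1 <= (d p K : \bar int).
  by apply: d1t uv _; apply: (lt_Stilde Yp); rewrite pK.
(* The index [p], chosen in [Y d f K], also lies in [Y d f N], since [d p N <= d p K < f p]. *)
rewrite -pK; apply: (le_trans _ NK); rewrite leeD2r //; apply: Stilde_le.
by apply: le_lt_trans Yp; apply: le_trans NK; rewrite leeDl.
Qed.

Lemma Stilde_d3 f : (forall p, cond_d3 (d p)) -> cond_d3 (Stilde d f).
Proof.
move=> d3 K L N u v uv LN.
have [p Yp pL] := Stilde_attained (lt_le_trans LN (leey _)).
have KL : (d p K : \bar int) <= d p L.
  by apply: d3 uv _; apply: (lt_Stilde Yp); rewrite pL.
(* Here [p] passes from [Y d f L] to [Y d f K]. *)
rewrite -pL; apply: (le_trans _ KL); apply: Stilde_le.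
exact: le_lt_trans KL Yp.
Qed.

End Proposition.

Unset Implicit Arguments.

Theorem proposition2p2 (R : pzRingType) (S : Type) (S_nonempty : inhabited S)
    (d : S -> lmodType R -> enat) (f : S -> enat) (U : set S) :
  (forall N : lmodType R,
     Stilde d f N = einf [set (d p N : \bar int) | p in Y d f N] :> \bar int) /\
  [/\ ((forall p, cond_d1tilde (d p)) -> cond_d1tilde (T d U)),
      ((forall p, cond_d3 (d p)) -> cond_d3 (T d U)) &
      ((forall p, [/\ cond_d1 (d p), cond_d2 (d p) & cond_d3 (d p)]) ->
       [/\ cond_d1 (T d U), cond_d2 (T d U) & cond_d3 (T d U)])] /\
  (((forall p, cond_d1tilde (d p)) -> cond_d1tilde (Stilde d f)) /\
   ((forall p, cond_d3 (d p)) -> cond_d3 (Stilde d f))).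
Proof.
split; first by move=> N; exact: Stilde_T.
split; last by split; [exact: Stilde_d1tilde|exact: Stilde_d3].
split; [exact: T_d1tilde|exact: T_d3|move=> d123].
have d1 p : cond_d1 (d p) by case: (d123 p).
have d2 p : cond_d2 (d p) by case: (d123 p).
by split; [exact: T_d1|exact: T_d2|apply: T_d3 => p; case: (d123 p)].
Qed.
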